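(* Let $\mathfrak g$ be a Borcherds-Bozec superalgebra, let $M=\bigoplus_{\lambda\in\mathfrak h^*}M_\lambda$ be a $\mathfrak g$-module in the category $\mathscr M$, and let $v\in M_\lambda$. Then the Casimir operator $\Omega$ on $M$ satisfies $$[\Omega,f_i](v)=0\quad\text{for } i\in I^{\mathrm{re}},$$ $$[\Omega,f_{il}](v)=(l^2-l)(\alpha_i,\alpha_i)f_{il}v\quad\text{for } i\in I^{\mathrm{im}},\ l\in\mathbf Z_{>0},$$ where $[\Omega,x](v)=\Omega(xv)-x\,\Omega(v)$.
   Context: **Datum.** $I$ is a (finite or countably infinite) index set. $A=(a_{ij})_{i,j\in I}$ is an integer matrix with $a_{ii}\in\{2,0,-2,-4,\dots\}$, $a_{ij}\le 0$ for $i\ne j$, and there are $d_i\in\mathbf Z_{>0}$ with $d_ia_{ij}=d_ja_{ji}$. Put $I^{\mathrm{re}}=\{i: a_{ii}=2\}$, $I^{\mathrm{im}}=\{i: a_{ii}\le 0\}$. An odd Borcherds-Cartan datum consists of $A$, a free abelian group $P$, $P^\vee=\operatorname{Hom}(P,\mathbf Z)$, $\Pi=\{\alpha_i\}_{i\in I}\subset P$, $\Pi^\vee=\{h_i\}_{i\in I}\subset P^\vee$ and a subset $I^{\mathrm{odd}}\subset I$ such that: $\langle h_i,\alpha_j\rangle=a_{ij}$; $\Pi$ is linearly independent over $\mathbf C$; $a_{ij}\in2\mathbf Z$ for all $i\in I^{\mathrm{re}}\cap I^{\mathrm{odd}}$, $j\in I$; for each $i\in I$ there is $\Lambda_i\in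 P$ with $\langle h_j,\Lambda_i\rangle=\delta_{ij}$ for all $j$. Put $I^{\mathrm{even}}=I\setminus I^{\mathrm{odd}}$, $\mathfrak h=\mathbf C\otimes_{\mathbf Z}P^\vee$, $Q=\bigoplus_i\mathbf Z\alpha_i$, $Q_+=\sum_i\mathbf Z_{\ge0}\alpha_i$. **Form on $\mathfrak h$ and $\mathfrak h^*$.** Write $\mathfrak h=\mathfrak h'\oplus\mathfrak h''$ with $\mathfrak h'=\bigoplus_i\mathbf Ch_i$ and $\mathfrak h''$ a complement. A symmetric bilinear form on $\mathfrak h$ is defined by $(h,h_i)=d_i^{-1}\langle h,\alpha_i\rangle$ for $h\in\mathfrak h$ and $(x,y)=0$ for $x,y\in\mathfrak h''$. It is non-degenerate and $\nu:\mathfrak h\to\mathfrak h^*$, $\nu(h)(h')=(h,h')$, is a linear isomorphism (standing assumptions); then $\nu^{-1}(\alpha_i)=d_ih_i$. On $\mathfrak h^*$ put $(\lambda,\mu)=(\nu^{-1}(\lambda),\nu^{-1}(\mu))$, so $(\alpha_i,\lambda)=d_i\langle h_i,\lambda\rangle$. Fix $\rho\in\mathfrak h^*$ with $(\rho,\alpha_i)=\frac12(\alpha_i,\alpha_i)$ for all $i\in I$. **Algebra.** Let $I^\infty=(I^{\mathrm{re}}\times\{1\})\sqcup(I^{\mathrm{im}}\times\mathbf Z_{>0})$, and write $i$ for $(i,1)$ (so $f_i=f_{i1}$). The Borcherds-Bozec superalgebra $\mathfrak g=\mathfrak g_{\bar0}\oplus\mathfrak g_{\bar1}$ is the Lie superalgebra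 over $\mathbf C$ generated by $\mathfrak h$ and $e_{il},f_{il}$ ($(i,l)\in I^\infty$) with relations: $[h,h']=0$; $[e_{il},f_{jk}]=l\,\delta_{ij}\delta_{kl}h_i$; $[h,e_{jl}]=l\langle h,\alpha_j\rangle e_{jl}$, $[h,f_{jl}]=-l\langle h,\alpha_j\rangle f_{jl}$; $(\operatorname{ad}e_i)^{1-la_{ij}}(e_{jl})=0=(\operatorname{ad}f_i)^{1-la_{ij}}(f_{jl})$ for $i\in I^{\mathrm{re}}$, $(i,1)\ne(j,l)$; $[e_{il},e_{jk}]=[f_{il},f_{jk}]=0$ if $a_{ij}=0$. Here $\mathfrak h\subset\mathfrak g_{\bar0}$, $e_{il},f_{il}\in\mathfrak g_{\bar0}$ for $i\in I^{\mathrm{even}}$, and $e_{il},f_{il}\in\mathfrak g_{\bar1}$ for $i\in I^{\mathrm{odd}}$ (for every $l$). For $\alpha\in Q$, $\mathfrak g_\alpha=\{x:[h,x]=\langle h,\alpha\rangle x\ \forall h\in\mathfrak h\}$; $\Delta=\{\alpha\in Q\setminus\{0\}:\mathfrak g_\alpha\ne0\}$, $\Delta_+=\Delta\cap Q_+$, and $\mathfrak g=\bigoplus_{\alpha\in\Delta_+}\mathfrak g_{-\alpha}\oplus\mathfrak h\oplus\bigoplus_{\alpha\in\Delta_+}\mathfrak g_\alpha$. **Form on $\mathfrak g$.** The form on $\mathfrak h$ is extended to a non-degenerate bilinear form on $\mathfrak g$ with $(\mathfrak g_\alpha,\mathfrak g_\beta)=0$ if $\alpha+\beta\neq0$, super-symmetric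 in the sense that $(x,y)=-(-1)^{|x||y|}(y,x)$ for homogeneous $x,y$ of parities $|x|,|y|$, invariant ($([x,y],z)=(x,[y,z])$), and with $[x,y]=(x,y)\nu^{-1}(\alpha)$ for $x\in\mathfrak g_\alpha$, $y\in\mathfrak g_{-\alpha}$, $\alpha\in\Delta_+$. For each $\alpha\in\Delta_+$ choose dual bases $\{e_\alpha^{(k)}\}$ of $\mathfrak g_\alpha$ and $\{e_{-\alpha}^{(k)}\}$ of $\mathfrak g_{-\alpha}$, $1\le k\le d_\alpha=\dim\mathfrak g_\alpha$, that is, $(e_\alpha^{(k)},e_{-\alpha}^{(l)})=\delta_{kl}$ and $(e_{-\alpha}^{(l)},e_{\alpha}^{(k)})=-\delta_{kl}$. **Category $\mathscr M$.** It consists of $\mathfrak g$-modules $M$ with $M=\bigoplus_{\lambda\in\mathfrak h^*}M_\lambda$, $M_\lambda=\{v:hv=\langle h,\lambda\rangle v\ \forall h\in\mathfrak h\}$, $\dim M_\lambda<\infty$ for all $\lambda$, and such that there are finitely many $\lambda_1,\dots,\lambda_s\in\mathfrak h^*$ with $\{\lambda:M_\lambda\ne0\}\subset\bigcup_j(\lambda_j-Q_+)$. **Casimir operator.** On $M\in\mathscr M$ let $\Omega_0=2\sum_{\alpha\in\Delta_+}\sum_{k=1}^{d_\alpha}e_{-\alpha}^{(k)}e_\alpha^{(k)}$ (only finitely many terms act non-trivially on a given weight vector), and define $\Omega$ linearly by $\Omega(v)=(\lambda+2\rho,\lambda)v+\Omega_0(v)$ for $v\in M_\lambda$.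
   Formalization: The form's supersymmetry is taken as (x,y)=(-1)^{|x||y|}(y,x), because the stated extra minus sign contradicts symmetry and non-degeneracy on h; the clause (e_{-α}^{(l)},e_α^{(k)})=-δ_kl on dual bases is correspondingly not imposed. *)

(* Defs.v *)
From HB Require Import structures.
From mathcomp Require Import all_boot all_order all_algebra.
From mathcomp Require Import sesquilinear complex.
From mathcomp Require Import boolp classical_sets fsbigop.
From mathcomp Require Import reals prodnormedzmodule.

Set Implicit Arguments.
Unset Strict Implicit.
Unset Printing Implicit Defensive.

Import Order.TTheory GRing.Theory Num.Theory.

Local Open Scope classical_set_scope.
Local Open Scope ring_scope.

(** * Duals *)

(* The abelian group Hom(U, V). *)
Section AdditiveZmodule.
Variables U V : zmodType.
Implicit Types f g h : {additive U -> V}.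

Lemma additive_ext f g : f =1 g -> f = g.
Proof.
case: f => f [[f_add]]; case: g => g [[g_add]] /= /funext efg.
by case: _ / efg g_add => g_add; rewrite (Prop_irrelevance f_add g_add).
Qed.

HB.instance Definition _ := gen_eqMixin {additive U -> V}.
HB.instance Definition _ := gen_choiceMixin {additive U -> V}.

Let zeroA : {additive U -> V} := \0.
Let oppA f : {additive U -> V} := \- f.
Let addA f g : {additive U -> V} := f \+ g.

Fact additive_addA : associative addA.
Proof. by move=> f g h; apply: additive_ext => x /=; rewrite addrA. Qed.
Fact additive_addC : commutative addA.
Proof. by move=> f g; apply: additive_ext => x /=; rewrite addrC. Qed.
Fact additive_add0 : left_id zeroA addA.
Proof. by move=> f; apply: additive_ext => x /=; rewrite add0r. Qed.
Fact additive_addN : left_inverse zeroA oppA addA.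
Proof. by move=> f; apply: additive_ext => x /=; rewrite addNr. Qed.

HB.instance Definition _ := GRing.isZmodule.Build {additive U -> V}
  additive_addA additive_addC additive_add0 additive_addN.
End AdditiveZmodule.

(* The algebraic dual of a vector space. *)
Section Dual.
Variables (K : fieldType) (V : lmodType K).
Implicit Types f g h : {scalar V}.

Lemma scalar_ext f g : f =1 g -> f = g.
Proof.
case: f => f [[f1] [f2]]; case: g => g [[g1] [g2]] /= /funext efg.
case: _ / efg g1 g2 => g1 g2.
by rewrite (Prop_irrelevance f1 g1) (Prop_irrelevance f2 g2).
Qed.

Let zeroS : {scalar V} := \0.
Let oppS f : {scalar V} := \- f.
Let addS f g : {scalar V} := f \+ g.
Definition scale_scalar_fun (a : K) f (x : V) : K := a * f x.
Fact scale_scalar_is_scalar a f : scalar (scale_scalar_fun a f).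
Proof.
by move=> b x y; rewrite /scale_scalar_fun linearP /= mulrDr mulrCA.
Qed.
HB.instance Definition _ a f :=
  GRing.isLinear.Build K V K *%R (scale_scalar_fun a f)
    (scale_scalar_is_scalar a f).
Let scaleS a f : {scalar V} := scale_scalar_fun a f.

Fact scalar_addA : associative addS.
Proof. by move=> f g h; apply: scalar_ext => x /=; rewrite addrA. Qed.
Fact scalar_addC : commutative addS.
Proof. by move=> f g; apply: scalar_ext => x /=; rewrite addrC. Qed.
Fact scalar_add0 : left_id zeroS addS.
Proof. by move=> f; apply: scalar_ext => x /=; rewrite add0r. Qed.
Fact scalar_addN : left_inverse zeroS oppS addS.
Proof. by move=> f; apply: scalar_ext => x /=; rewrite addNr. Qed.

HB.instance Definition _ := GRing.isZmodule.Build {scalar V}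
  scalar_addA scalar_addC scalar_add0 scalar_addN.

Fact scalar_scaleA a b f : scaleS a (scaleS b f) = scaleS (a * b) f.
Proof. by apply: scalar_ext => x /=; rewrite /scale_scalar_fun /= mulrA. Qed.
Fact scalar_scale1 : left_id 1 scaleS.
Proof. by move=> f; apply: scalar_ext => x /=; rewrite /scale_scalar_fun mul1r. Qed.
Fact scalar_scaleDr : right_distributive scaleS +%R.
Proof.
by move=> a f g; apply: scalar_ext => x /=; rewrite /scale_scalar_fun /= mulrDr.
Qed.
Fact scalar_scaleDl f : {morph scaleS^~ f : a b / a + b}.
Proof.
by move=> a b; apply: scalar_ext => x /=; rewrite /scale_scalar_fun /= mulrDl.
Qed.

HB.instance Definition _ := GRing.Zmodule_isLmodule.Build K {scalar V}
  scalar_scaleA scalar_scale1 scalar_scaleDr scalar_scaleDl.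
End Dual.

(** * Linear algebra *)

Section LinearAlgebra.
Variables (K : fieldType) (V : lmodType K).

Definition is_subspace (S : set V) : Prop :=
  S 0 /\ forall (a : K) x y, S x -> S y -> S (a *: x + y).

Definition linear_span (J : eqType) (F : J -> V) : set V :=
  [set x | exists (s : seq J) (c : J -> K), x = \sum_(j <- s) c j *: F j].

Definition linearly_independent (J : eqType) (F : J -> V) : Prop :=
  forall (s : seq J) (c : J -> K), uniq s ->
    \sum_(j <- s) c j *: F j = 0 -> {in s, forall j, c j = 0}.

Definition is_basis (S : set V) (n : nat) (x : 'I_n -> V) : Prop :=
  [/\ forall k, S (x k),
      forall c : 'I_n -> K, \sum_k c k *: x k = 0 -> forall k, c k = 0
    & forall y, S y -> exists c : 'I_n -> K, y = \sum_k c k *: x k].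

Definition finite_dimensional (S : set V) : Prop :=
  exists (n : nat) (x : 'I_n -> V), is_basis S x.

(* V is the internal direct sum of the family of subsets S. *)
Definition is_direct_sum (J : eqType) (S : J -> set V) : Prop :=
  (forall v, exists (s : seq J) (w : J -> V),
     (forall j, S j (w j)) /\ v = \sum_(j <- s) w j) /\
  (forall (s : seq J) (w : J -> V), uniq s -> (forall j, S j (w j)) ->
     \sum_(j <- s) w j = 0 -> {in s, forall j, w j = 0}).
End LinearAlgebra.

Definition free_abelian (P : zmodType) : Prop :=
  exists (B : choiceType) (b : B -> P),
    (forall x, exists (s : seq B) (n : B -> int),
       x = \sum_(j <- s) b j *~ n j) /\
    (forall (s : seq B) (n : B -> int), uniq s ->
       \sum_(j <- s) b j *~ n j = 0 -> {in s, forall j, n j = 0}).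

(* K (x)_Z A, characterised by its universal property. *)
Record scalar_extension (K : fieldType) (A : zmodType) := ScalarExtension {
  se_car :> lmodType K;
  se_in : {additive A -> se_car};
  se_univ : forall (V : lmodType K) (g : {additive A -> V}),
    exists u : {linear se_car -> V},
      (forall x, u (se_in x) = g x) /\
      (forall u' : {linear se_car -> V},
         (forall x, u' (se_in x) = g x) -> u' =1 u)
}.
Arguments se_in {K A} s.

(* An element x of P, seen as a linear form on K (x)_Z Hom(P, Z): the linear
   extension of evaluation at x. *)
Section Weight.
Variables (K : fieldType) (P : zmodType).
Variable H : scalar_extension K {additive P -> int}.

Definition evaluation (x : P) (f : {additive P -> int}) : K^o := (f x)%:~R.

Fact evaluation_additive x : zmod_morphism (evaluation x).
Proof. by move=> f g; rewrite /evaluation /= rmorphB. Qed.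
HB.instance Definition _ x := GRing.isZmodMorphism.Build
  {additive P -> int} K^o (evaluation x) (evaluation_additive x).

Definition weight_fun (x : P) (h : H) : K :=
  projT1 (cid (se_univ H (evaluation x))) h.

Fact weight_scalar x : scalar (weight_fun x).
Proof. by move=> a h h'; rewrite /weight_fun linearP. Qed.
HB.instance Definition _ x :=
  GRing.isLinear.Build K H K *%R (weight_fun x) (weight_scalar x).

Definition weight (x : P) : {scalar H} := weight_fun x.

Lemma weightE x (f : {additive P -> int}) : weight x (se_in H f) = (f x)%:~R.
Proof.
by rewrite /weight /= /weight_fun; case: cid => u [uE _] /=; rewrite uE.
Qed.
End Weight.

(** * Odd Borcherds-Cartan data *)

Record bc_datum (R : realType) (I : countType) := BCDatum {
  bc_a : I -> I -> int;
  bc_d : I -> nat;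
  bc_P : zmodType;
  bc_alpha : I -> bc_P;
  bc_h : I -> {additive bc_P -> int};
  bc_odd : pred I;
  bc_cartan : scalar_extension R[i] {additive bc_P -> int};
  bc_diag : forall i,
    bc_a i i = 2 \/ (bc_a i i <= 0 /\ (2 %| bc_a i i)%Z);
  bc_offdiag : forall i j, i != j -> bc_a i j <= 0;
  bc_d_gt0 : forall i, (0 < bc_d i)%N;
  bc_sym : forall i j, (bc_d i)%:Z * bc_a i j = (bc_d j)%:Z * bc_a j i;
  bc_free : free_abelian bc_P;
  bc_pairing : forall i j, bc_h i (bc_alpha j) = bc_a i j;
  bc_indep : linearly_independent (fun i => weight bc_cartan (bc_alpha i));
  bc_odd_even : forall i j, bc_a i i = 2 -> bc_odd i -> (2 %| bc_a i j)%Z;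
  bc_fund : forall i, exists L : bc_P, forall j, bc_h j L = (i == j)%:R
}.

Section Datum.
Variables (R : realType) (I : countType) (D : bc_datum R I).

Definition is_real (i : I) : bool := bc_a D i i == 2.
Definition is_imaginary (i : I) : bool := bc_a D i i <= 0.

(* (i, l) belongs to I^oo. *)
Definition in_Iinf (i : I) (l : nat) : bool :=
  (is_real i && (l == 1)%N) || (is_imaginary i && (0 < l)%N).

Definition hh (i : I) : bc_cartan D := se_in (bc_cartan D) (bc_h D i).
Definition wt (x : bc_P D) : {scalar bc_cartan D} := weight (bc_cartan D) x.
Definition alpha (i : I) : {scalar bc_cartan D} := wt (bc_alpha D i).

Definition root_lattice : set (bc_P D) :=
  [set x | exists (s : seq I) (n : I -> int),
     x = \sum_(i <- s) bc_alpha D i *~ n i].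
Definition positive_cone : set (bc_P D) :=
  [set x | exists (s : seq I) (n : I -> nat),
     x = \sum_(i <- s) bc_alpha D i *+ n i].
End Datum.
Arguments root_lattice {R I} D.
Arguments positive_cone {R I} D.

(* The form on h attached to a complement h'' of h' = (+)_i C h_i. *)
Record cartan_form (R : realType) (I : countType) (D : bc_datum R I) :=
  CartanForm {
  cf_compl : set (bc_cartan D);
  cf_form :> {biscalar (bc_cartan D)};
  cf_nuinv : {scalar bc_cartan D} -> bc_cartan D;
  cf_compl_sub : is_subspace cf_compl;
  cf_compl_sum : forall x, exists y z,
    [/\ linear_span (hh D) y, cf_compl z & x = y + z];
  cf_compl_cap : forall x, linear_span (hh D) x -> cf_compl x -> x = 0;
  cf_symmetric : forall x y, cf_form x y = cf_form y x;
  cf_hh : forall x i, cf_form x (hh D i) = (bc_d D i)%:R^-1 * alpha D i x;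
  cf_compl0 : forall x y, cf_compl x -> cf_compl y -> cf_form x y = 0;
  cf_nondeg : forall x, (forall y, cf_form x y = 0) -> x = 0;
  (* nu : h -> h^* is x |-> cf_form x, and cf_nuinv is its inverse *)
  cf_nuK : cancel (fun x => cf_form x : {scalar bc_cartan D}) cf_nuinv;
  cf_nuinvK : cancel cf_nuinv (fun x => cf_form x : {scalar bc_cartan D})
}.

Definition dual_form (R : realType) (I : countType) (D : bc_datum R I)
    (B : cartan_form D) (l m : {scalar bc_cartan D}) : R[i] :=
  B (cf_nuinv B l) (cf_nuinv B m).

(** * Lie superalgebras *)

(* [ls_par false] and [ls_par true] are the even and the odd part. *)
Record lieSuperalgebra (K : fieldType) := LieSuperalgebra {
  ls_car :> lmodType K;
  ls_par : bool -> set ls_car;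
  ls_br : {bilinear ls_car -> ls_car -> ls_car};
  ls_par_sub : forall p, is_subspace (ls_par p);
  ls_par_sum : is_direct_sum ls_par;
  ls_br_par : forall p q x y,
    ls_par p x -> ls_par q y -> ls_par (p (+) q) (ls_br x y);
  ls_anti : forall p q x y, ls_par p x -> ls_par q y ->
    ls_br x y = - ((-1) ^+ (p && q) *: ls_br y x);
  ls_jacobi : forall p q x y z, ls_par p x -> ls_par q y ->
    ls_br x (ls_br y z) =
    ls_br (ls_br x y) z + (-1) ^+ (p && q) *: ls_br y (ls_br x z)
}.
Arguments ls_par {K} l.
Arguments ls_br {K} l.

Definition is_ls_morphism (K : fieldType) (L L' : lieSuperalgebra K)
    (f : {linear L -> L'}) : Prop :=
  (forall p x, ls_par L p x -> ls_par L' p (f x)) /\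
  (forall x y, f (ls_br L x y) = ls_br L' (f x) (f y)).

(** * Borcherds-Bozec superalgebras *)

(* Only the values of [gen_e], [gen_f] at the pairs of I^oo are used. *)
Record bb_generators (R : realType) (I : countType) (D : bc_datum R I)
    (L : lmodType R[i]) := BBGenerators {
  gen_h : {linear bc_cartan D -> L};
  gen_e : I -> nat -> L;
  gen_f : I -> nat -> L
}.

Section Presentation.
Variables (R : realType) (I : countType) (D : bc_datum R I).

Section Relations.
Variables (L : lieSuperalgebra R[i]) (G : bb_generators D L).
Local Notation a := (bc_a D).
Local Notation h := (gen_h G).
Local Notation e := (gen_e G).
Local Notation f := (gen_f G).
Local Notation "[[ x , y ]]" := (ls_br L x y) (at level 0, x, y at level 99).

Record bb_relations : Prop := BBRelations {
  rel_par_h : forall x, ls_par L false (h x);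
  rel_par_e : forall i l, in_Iinf D i l -> ls_par L (bc_odd D i) (e i l);
  rel_par_f : forall i l, in_Iinf D i l -> ls_par L (bc_odd D i) (f i l);
  rel_hh : forall x y, [[h x, h y]] = 0;
  rel_ef : forall i l j k, in_Iinf D i l -> in_Iinf D j k ->
    [[e i l, f j k]] = (l * (i == j) * (k == l))%:R *: h (hh D i);
  rel_he : forall x j l, in_Iinf D j l ->
    [[h x, e j l]] = (l%:R * alpha D j x) *: e j l;
  rel_hf : forall x j l, in_Iinf D j l ->
    [[h x, f j l]] = - (l%:R * alpha D j x) *: f j l;
  (* 1 - l a_ij is nonnegative here, so that the absolute value is harmless *)
  rel_serre_e : forall i j l, is_real D i -> in_Iinf D j l ->
    (i, 1%N) != (j, l) ->
    iter (absz (1 - l%:Z * a i j)%R) (ls_br L (e i 1)) (e j l) = 0;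
  rel_serre_f : forall i j l, is_real D i -> in_Iinf D j l ->
    (i, 1%N) != (j, l) ->
    iter (absz (1 - l%:Z * a i j)%R) (ls_br L (f i 1)) (f j l) = 0;
  rel_ee : forall i l j k, in_Iinf D i l -> in_Iinf D j k -> a i j = 0 ->
    [[e i l, e j k]] = 0;
  rel_ff : forall i l j k, in_Iinf D i l -> in_Iinf D j k -> a i j = 0 ->
    [[f i l, f j k]] = 0
}.

Definition bb_generate : Prop :=
  forall S : set L, is_subspace S -> (forall x y, S x -> S y -> S [[x, y]]) ->
    (forall x, S (h x)) -> (forall i l, in_Iinf D i l -> S (e i l)) ->
    (forall i l, in_Iinf D i l -> S (f i l)) -> forall x, S x.
End Relations.

(* The Lie superalgebra presented by these generators and relations. *)
Record bb_superalgebra := BBSuperalgebra {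
  bb_lie :> lieSuperalgebra R[i];
  bb_gen : bb_generators D bb_lie;
  bb_rel : bb_relations bb_gen;
  bb_genP : bb_generate bb_gen;
  bb_univ : forall (L : lieSuperalgebra R[i]) (G : bb_generators D L),
    bb_relations G ->
    exists u : {linear bb_lie -> L},
      [/\ is_ls_morphism u,
          forall x, u (gen_h bb_gen x) = gen_h G x,
          forall i l, in_Iinf D i l -> u (gen_e bb_gen i l) = gen_e G i l
        & forall i l, in_Iinf D i l -> u (gen_f bb_gen i l) = gen_f G i l]
}.

Variable g : bb_superalgebra.

Definition root_space (b : bc_P D) : set g :=
  [set x | forall h, ls_br g (gen_h (bb_gen g) h) x = wt b h *: x].

Definition roots : set (bc_P D) :=
  [set b | [/\ root_lattice D b, b != 0 & exists2 x, root_space b x & x != 0]].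

Definition positive_roots : set (bc_P D) := roots `&` positive_cone D.
End Presentation.

Section InvariantForm.
Variables (R : realType) (I : countType) (D : bc_datum R I).
Variables (B : cartan_form D) (g : bb_superalgebra D).
Local Notation h := (gen_h (bb_gen g)).

Record invariant_form := InvariantForm {
  if_form :> {biscalar g};
  if_cartan : forall x y, if_form (h x) (h y) = B x y;
  if_nondegl : forall x, (forall y, if_form x y = 0) -> x = 0;
  if_nondegr : forall y, (forall x, if_form x y = 0) -> y = 0;
  if_orth : forall b c x y, root_lattice D b -> root_lattice D c ->
    b + c != 0 -> root_space b x -> root_space c y -> if_form x y = 0;
  (* The sign is the one compatible with the symmetry of the form on h: the
     opposite one would make the form alternating there. *)
  if_super : forall p q x y, ls_par g p x -> ls_par g q y ->
    if_form x y = (-1) ^+ (p && q) * if_form y x;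
  if_invariant : forall x y z,
    if_form (ls_br g x y) z = if_form x (ls_br g y z);
  if_bracket : forall b x y, positive_roots g b ->
    root_space b x -> root_space (- b) y ->
    ls_br g x y = if_form x y *: h (cf_nuinv B (wt b))
}.

(* Dual bases of g_b and g_{-b}, for every positive root b. The values with the
   arguments exchanged follow from [if_super]. *)
Record dual_bases (F : invariant_form) := DualBases {
  db_dim : bc_P D -> nat;
  db_pos : forall b, 'I_(db_dim b) -> g;
  db_neg : forall b, 'I_(db_dim b) -> g;
  db_pos_basis : forall b, positive_roots g b ->
    is_basis (root_space b) (@db_pos b);
  db_neg_basis : forall b, positive_roots g b ->
    is_basis (root_space (- b)) (@db_neg b);
  db_dual : forall b (k l : 'I_(db_dim b)), positive_roots g b ->
    F (db_pos k) (db_neg l) = (k == l)%:R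
}.
End InvariantForm.
Arguments db_pos {R I D B g F} d b k.
Arguments db_neg {R I D B g F} d b k.

(** * Modules and the Casimir operator *)

(* The underlying space need not carry a compatible parity grading. *)
Record ls_module (K : fieldType) (L : lieSuperalgebra K) := LSModule {
  mod_car :> lmodType K;
  mod_act : {bilinear L -> mod_car -> mod_car};
  mod_actP : forall p q x y v, ls_par L p x -> ls_par L q y ->
    mod_act (ls_br L x y) v =
    mod_act x (mod_act y v) - (-1) ^+ (p && q) *: mod_act y (mod_act x v)
}.
Arguments mod_act {K L} l.

Section Modules.
Variables (R : realType) (I : countType) (D : bc_datum R I).
Variables (g : bb_superalgebra D) (M : ls_module g).

Definition weight_space (l : {scalar bc_cartan D}) : set M :=
  [set v | forall x, mod_act M (gen_h (bb_gen g) x) v = l x *: v].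

Definition in_category_M : Prop :=
  [/\ is_direct_sum weight_space,
      forall l, finite_dimensional (weight_space l)
    & exists s : seq {scalar bc_cartan D}, forall l,
        (exists2 v, weight_space l v & v != 0) ->
        exists2 m, m \in s &
          exists2 b, positive_cone D b & l = m - wt b].

Variables (B : cartan_form D) (F : invariant_form B g) (E : dual_bases F).

(* On a weight vector only finitely many summands are nonzero. *)
Definition Omega0 (v : M) : M :=
  2 *: \sum_(b \in positive_roots g)
         \sum_(k < db_dim E b)
           mod_act M (db_neg E b k) (mod_act M (db_pos E b k) v).

Definition is_casimir (rho : {scalar bc_cartan D}) (Omega : {linear M -> M}) :
    Prop :=
  forall l v, weight_space l v ->
    Omega v = dual_form B (l + 2 *: rho) l *: v + Omega0 v.

(* [Omega, x](v) *)
Definition casimir_commutator (Omega : {linear M -> M}) (x : g) (v : M) : M :=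
  Omega (mod_act M x v) - mod_act M x (Omega v).
End Modules.

(* Main.v *)
Require Import Defs.
From HB Require Import structures.
From mathcomp Require Import all_boot all_order all_algebra.
From mathcomp Require Import sesquilinear complex.
From mathcomp Require Import boolp classical_sets cardinality fsbigop.
From mathcomp Require Import reals prodnormedzmodule.
From mathcomp Require Import ring.

Set Implicit Arguments.
Unset Strict Implicit.
Unset Printing Implicit Defensive.

Import Order.TTheory GRing.Theory Num.Theory.

Local Open Scope classical_set_scope.
Local Open Scope ring_scope.

(** Write z for f_il, c for l alpha_i, and let v have weight lambda.  The scalar
    part of Omega changes by
      (lambda - c + 2 rho, lambda - c) - (lambda + 2 rho, lambda)
        = (l^2 - l) (alpha_i, alpha_i) - 2 (lambda, c)
    between v and z v, so everything reduces to
      Omega_0 (z v) - z Omega_0 v = 2 (lambda, c) z v     ([Omega0_commutator]);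
    for a real i one has l = 1, and l^2 - l vanishes.

    Fix a positive root b and let e_k, e'_k denote the dual bases of g_b and
    g_(-b).  The engine is the following property of dual bases
    ([dual_bases_adjoint]): if T and T' are adjoint for the form, then the sum
    of the T' e'_k (x) e_k equals the sum of the e'_k (x) T e_k.  It is used
    for two pairs.  The parity twist x |-> (-1)^(|x||z|) x is its own adjoint,
    because the form is even on g_b x g_(-b): the bracket of elements of
    opposite parities is odd, but it is a multiple of a nonzero element of h
    ([form_parity]).  This makes the signs disappear when z is moved through
    e'_k e_k, even for bases that are not homogeneous, and gives
    ([casimir_term_commutator])
      sum_k e'_k e_k z v = z sum_k e'_k e_k v
                           + sum_k e'_k [e_k, z] v - sum_k [z, e'_k] e_k v.
    The second pair is [-, z] and [z, -].  It shows that the first correction at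
    b + c equals the second one at b ([raising_term_shift]), so that they cancel
    in the sum over all positive roots, except that the first correction at
    b = c has no partner.  There [e_k, z] = (e_k, z) nu^-1(c), and the
    correction is (lambda, c) z v ([raising_term_generator]).

    What remains is that the corrections without partner vanish otherwise.  The
    delicate case is a positive root b different from c such that b - c is not
    in Q_+.  Then alpha_i has coefficient less than l in b.  The
    triangular decomposition, which is proved here from the presentation, makes
    g_b a span of iterated brackets of letters e_jk, among which e_il cannot
    occur; all these letters commute with f_il ([root_bracket_f]).

    Coefficients of roots are read off by elements of h that are dual to the
    alpha_i ([coweight]); they are images under nu^-1 of the rescaled
    fundamental weights.  *)

(** * Subspaces and spans *)

Section Subspaces.
Variables (K : fieldType) (V : lmodType K).
Implicit Types (S : set V) (x y : V) (a : K).

Section Closure.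
Variables (S : set V) (S_sub : is_subspace S).

Lemma subspaceD x y : S x -> S y -> S (x + y).
Proof. by case: S_sub => _ SP Sx Sy; rewrite -[x]scale1r; apply: SP. Qed.

Lemma subspaceZ a x : S x -> S (a *: x).
Proof. by case: S_sub => S0 SP Sx; rewrite -[_ *: _]addr0; apply: SP. Qed.

Lemma subspaceB x y : S x -> S y -> S (x - y).
Proof. by move=> Sx Sy; rewrite -scaleN1r; apply/subspaceD/subspaceZ. Qed.
End Closure.

(** The linear span as an inductive predicate: no indexing of the vectors is
    needed, and linear statements are proved by induction. *)
Inductive spanned (P : V -> Prop) : V -> Prop :=
| spanned0 : spanned P 0
| spanned_cons a x y : P x -> spanned P y -> spanned P (a *: x + y).

Lemma spanned_subspace (P : V -> Prop) : is_subspace (spanned P).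
Proof.
split=> [|a x y Px Py]; first exact: spanned0.
elim: Px => [|b u w Pu _ IH]; first by rewrite scaler0 add0r.
by rewrite scalerDr scalerA -addrA; apply: spanned_cons.
Qed.

Lemma spannedW (P : V -> Prop) x : P x -> spanned P x.
Proof.
move=> Px; rewrite -[x]scale1r -[_ *: _]addr0.
exact: spanned_cons Px (spanned0 _).
Qed.

Lemma spanned_ind_subspace (P : V -> Prop) S :
  is_subspace S -> (forall x, P x -> S x) -> forall x, spanned P x -> S x.
Proof.
move=> S_sub PS x; elim=> [|a u w /PS Su _ Sw]; first by case: S_sub.
exact/(subspaceD S_sub)/Sw/(subspaceZ S_sub).
Qed.
End Subspaces.

Lemma linear_spanned (K : fieldType) (U V : lmodType K) (f : {linear U -> V})
    (P : U -> Prop) (S : set V) :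
  is_subspace S -> (forall x, P x -> S (f x)) ->
  forall x, spanned P x -> S (f x).
Proof.
move=> S_sub PS; apply: (spanned_ind_subspace (S := S \o f)) => //.
split=> [|a x y] /=; first by rewrite linear0; case: S_sub.
by rewrite linearP; case: S_sub => _; apply.
Qed.

Lemma spanned_sub (K : fieldType) (V : lmodType K) (P Q : V -> Prop) :
  (forall x, P x -> Q x) -> forall x, spanned P x -> spanned Q x.
Proof.
move=> PQ; apply: (spanned_ind_subspace (spanned_subspace Q)) => x Px.
exact/spannedW/PQ.
Qed.

Lemma spanned_split (K : fieldType) (V : lmodType K) (P Q Q' : V -> Prop) x :
  (forall y, P y -> Q y \/ Q' y) -> spanned P x ->
  exists y z, [/\ spanned Q y, spanned Q' z & x = y + z].
Proof.
move=> PQ; elim=> [|a u w Pu _ [y [z [Qy Qz ->]]]].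
  by exists 0, 0; split; rewrite ?addr0 //; apply: spanned0.
have [Qu|Qu] := PQ u Pu.
  by exists (a *: u + y), z; split=> //; [apply: spanned_cons|rewrite addrA].
by exists y, (a *: u + z); split=> //; [apply: spanned_cons|rewrite addrCA].
Qed.

(** * Parity twists *)

Section Twist.
Variables (K : fieldType) (L : lieSuperalgebra K).
Implicit Types x y z : L.

Lemma parity_decomposition x :
  exists x0 x1, [/\ ls_par L false x0, ls_par L true x1 & x = x0 + x1].
Proof.
have [/(_ x)[s [w [parw ->]]] _] := ls_par_sum L.
elim: s => [|q s [x0 [x1 [par0 par1 IH]]]].
  exists 0, 0; rewrite big_nil addr0.
  by split=> //; [case: (ls_par_sub L false)|case: (ls_par_sub L true)].
rewrite big_cons IH; case: q.
  exists x0, (w true + x1); rewrite addrCA.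
  by split=> //; apply: (subspaceD (ls_par_sub L _)).
exists (w false + x0), x1; rewrite addrA.
by split=> //; apply: (subspaceD (ls_par_sub L _)).
Qed.

Lemma parity_disjoint x : ls_par L false x -> ls_par L true x -> x = 0.
Proof.
move=> par0 par1; have [_] := ls_par_sum L.
move=> /(_ [:: false; true] (fun q => if q then - x else x)).
rewrite !big_cons big_nil addr0 subrr => /(_ isT) /(_ _ erefl false).
apply; last by rewrite inE.
case=> //; rewrite -scaleN1r.
exact: (subspaceZ (ls_par_sub L _)).
Qed.

(** The twist by p multiplies x by (-1)^(p |x|).  It absorbs the sign in all
    brackets with an element of parity p, whether or not x is homogeneous. *)
Fact twist_exists (p : bool) x : exists y x0 x1,
  [/\ ls_par L false x0, ls_par L true x1, x = x0 + x1
    & y = x0 + (-1) ^+ p *: x1].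
Proof.
have [x0 [x1 [par0 par1 ->]]] := parity_decomposition x.
by exists (x0 + (-1) ^+ p *: x1), x0, x1.
Qed.

Definition twist (p : bool) x : L := projT1 (cid (twist_exists p x)).

Lemma twistP p x : exists x0 x1,
  [/\ ls_par L false x0, ls_par L true x1, x = x0 + x1
    & twist p x = x0 + (-1) ^+ p *: x1].
Proof. exact: projT2 (cid (twist_exists p x)). Qed.

Lemma even_bracketDr x y z : ls_par L false x ->
  ls_br L x (ls_br L y z) = ls_br L (ls_br L x y) z + ls_br L y (ls_br L x z).
Proof.
move=> parx; have [y0 [y1 [par0 par1 ->]]] := parity_decomposition y.
rewrite !linearDl !linearDr !linearDl.
rewrite (ls_jacobi z parx par0) (ls_jacobi z parx par1).
by rewrite expr0 !scale1r addrACA.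
Qed.

Section Modules.
Variable M : ls_module L.
Local Notation act := (mod_act M).

Lemma act_bracket_even x y v : ls_par L false x ->
  act (ls_br L x y) v = act x (act y v) - act y (act x v).
Proof.
move=> parx; have [y0 [y1 [par0 par1 ->]]] := parity_decomposition y.
rewrite !linearDr !linearDl linearDr.
rewrite (mod_actP _ parx par0) (mod_actP _ parx par1).
by rewrite expr0 !scale1r opprD addrACA.
Qed.

Lemma act_bracketr p x z v : ls_par L p z ->
  act (ls_br L x z) v = act x (act z v) - act z (act (twist p x) v).
Proof.
move=> parz; have [x0 [x1 [par0 par1 xE ->]]] := twistP p x; rewrite xE.
rewrite !linearDl linearDr (mod_actP _ par0 parz) (mod_actP _ par1 parz).
by rewrite linearZl_LR linearZr_LR /= expr0 scale1r opprD addrACA.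
Qed.

Lemma act_bracketl p x z v : ls_par L p z ->
  act (ls_br L z x) v = act z (act x v) - act (twist p x) (act z v).
Proof.
move=> parz; have [x0 [x1 [par0 par1 xE ->]]] := twistP p x; rewrite xE.
rewrite !(linearDl, linearDr) (mod_actP _ parz par0) (mod_actP _ parz par1).
by rewrite linearZl_LR /= andbF andbT expr0 scale1r opprD addrACA.
Qed.
End Modules.
End Twist.

Lemma bracket_derivation (K : fieldType) (L : lieSuperalgebra K) p (x y z : L) :
  ls_par L p x ->
  ls_br L x (ls_br L y z) =
  ls_br L (ls_br L x y) z + ls_br L (twist p y) (ls_br L x z).
Proof.
move=> parx; have [y0 [y1 [par0 par1 yE ->]]] := twistP p y; rewrite yE.
rewrite !(linearDl, linearDr) (ls_jacobi z parx par0) (ls_jacobi z parx par1).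
by rewrite linearZl_LR /= andbF andbT expr0 scale1r addrACA.
Qed.

Lemma parity_unique (K : fieldType) (L : lieSuperalgebra K) (x0 x1 y0 y1 : L) :
  ls_par L false x0 -> ls_par L true x1 ->
  ls_par L false y0 -> ls_par L true y1 ->
  x0 + x1 = y0 + y1 -> x0 = y0 /\ x1 = y1.
Proof.
move=> px0 px1 py0 py1 xy; have xyE : x0 - y0 = y1 - x1.
  by apply/eqP; rewrite subr_eq addrAC eq_sym subr_eq xy addrC.
have xy0 : x0 - y0 = 0.
  apply: (@parity_disjoint _ L); last rewrite xyE.
    exact: (subspaceB (ls_par_sub L _)).
  exact: (subspaceB (ls_par_sub L _)).
split; first by apply/eqP; rewrite -subr_eq0 xy0.
by apply/eqP; rewrite eq_sym -subr_eq0 -xyE xy0.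
Qed.


(** * Weights and the positive cone *)

(** Uniqueness in the universal property of K (x) A, for maps to K. *)
Lemma scalar_extension_ext (K : fieldType) (A : zmodType)
    (H : scalar_extension K A) (f g : {scalar H}) :
  (forall x, f (se_in H x) = g (se_in H x)) -> f = g.
Proof.
move=> fg; apply: scalar_ext => h.
pose k x : K^o := g (se_in H x).
have k_add : zmod_morphism k by move=> x y; rewrite /k !raddfB.
pose K1 := GRing.isZmodMorphism.Build A K^o k k_add.
pose k' : {additive A -> K^o} := HB.pack k K1.
have [u [_ u_uniq]] := se_univ H k'.
have uf : (f : H -> K) =1 u.
  by apply: (u_uniq (f : {linear H -> K^o})) => x; rewrite fg.
have ug : (g : H -> K) =1 u by apply: (u_uniq (g : {linear H -> K^o})).
by rewrite uf ug.
Qed.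

Section Weights.
Variables (R : realType) (I : countType) (D : bc_datum R I).
Implicit Types (b c : bc_P D) (t : seq I) (i j : I).

Fact wt_is_zmod_morphism : zmod_morphism (@wt R I D).
Proof.
move=> b c; apply: scalar_extension_ext => x.
by rewrite /wt weightE raddfB rmorphB /= !weightE.
Qed.
HB.instance Definition _ :=
  GRing.isZmodMorphism.Build _ _ (@wt R I D) wt_is_zmod_morphism.

Lemma wtDE b c x : wt (b + c) x = wt b x + wt c x.
Proof. by rewrite raddfD. Qed.

Lemma wtNE b x : wt (- b) x = - wt b x.
Proof. by rewrite raddfN. Qed.

(** Elements of Q_+ are represented by words in I, so that coefficients become
    multiplicities and equality becomes [perm_eq]. *)
Definition root_sum t : bc_P D := \sum_(i <- t) bc_alpha D i.

Lemma root_sum_nseq i l : root_sum (nseq l i) = bc_alpha D i *+ l.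
Proof. by rewrite /root_sum big_nseq -Monoid.iteropE. Qed.

Lemma root_sum_cat t1 t2 : root_sum (t1 ++ t2) = root_sum t1 + root_sum t2.
Proof. exact: big_cat. Qed.

Lemma positive_coneP b : positive_cone D b <-> exists t, b = root_sum t.
Proof.
split=> [[s [n ->]]|[t ->]]; last first.
  by exists t, (fun=> 1%N).
exists (flatten [seq nseq (n i) i | i <- s]).
rewrite /root_sum big_flatten big_map; apply: eq_bigr => i _.
exact/esym/root_sum_nseq.
Qed.

Lemma root_lattice_sum t : root_lattice D (root_sum t).
Proof. by exists t, (fun=> 1). Qed.

End Weights.

Section CartanForm.
Variables (R : realType) (I : countType) (D : bc_datum R I) (B : cartan_form D).
Implicit Types (l m : {scalar bc_cartan D}) (b c : bc_P D).
Implicit Types (t : seq I) (i j : I).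
Local Notation nuinv := (cf_nuinv B).

Lemma form_nuinv l y : B (nuinv l) y = l y.
Proof. by rewrite -[in RHS](cf_nuinvK B l). Qed.

Lemma dual_formE l m : dual_form B l m = l (nuinv m).
Proof. exact: form_nuinv. Qed.

Lemma dual_formC l m : dual_form B l m = dual_form B m l.
Proof. exact: cf_symmetric. Qed.

Lemma dual_formDl l l' m :
  dual_form B (l + l') m = dual_form B l m + dual_form B l' m.
Proof. by rewrite !dual_formE. Qed.

Lemma dual_formZl a l m : dual_form B (a *: l) m = a * dual_form B l m.
Proof. by rewrite !dual_formE. Qed.

Lemma dual_formNl l m : dual_form B (- l) m = - dual_form B l m.
Proof. by rewrite !dual_formE. Qed.

Lemma bc_d_neq0 i : (bc_d D i)%:R != 0 :> R[i].
Proof. by rewrite pnatr_eq0 -lt0n bc_d_gt0. Qed.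

Lemma hh_neq0 i : hh D i != 0.
Proof.
have [b /(_ i)] := bc_fund D i; rewrite eqxx => bE.
have := weightE (bc_cartan D) b (bc_h D i); rewrite bE.
apply: contra_eqN => /eqP hh0; rewrite -[se_in _ _]/(hh D i) hh0 raddf0.
by rewrite eq_sym oner_eq0.
Qed.

(** Since (h_i, nu^-1(L)) = <h_i, L> is also alpha_i(nu^-1(L)) / d_i, a
    fundamental weight L at j gives nu^-1(L) / d_j as dual vector to alpha_j. *)
Fact coweight_exists j : exists x, forall i, alpha D i x = (i == j)%:R.
Proof.
have [b bE] := bc_fund D j.
exists ((bc_d D j)%:R^-1 *: nuinv (wt b)) => i.
have := cf_hh B (nuinv (wt b)) i; rewrite form_nuinv [LHS]weightE bE.
rewrite linearZ /= => /(congr1 ( *%R (bc_d D i)%:R)).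
rewrite mulrA divff ?bc_d_neq0 // mul1r => <-.
rewrite eq_sym; have [->|_] := eqVneq i j; last by rewrite !mulr0.
by rewrite mulrA mulVf ?bc_d_neq0 // mul1r.
Qed.

Definition coweight j := projT1 (cid (coweight_exists j)).

Lemma alpha_coweight i j : alpha D i (coweight j) = (i == j)%:R.
Proof. exact: projT2 (cid (coweight_exists j)) i. Qed.

Lemma wt_coweight t j : wt (root_sum D t) (coweight j) = (count_mem j t)%:R.
Proof.
elim: t => [|i t IH]; first by rewrite /root_sum big_nil raddf0.
by rewrite /root_sum big_cons wtDE IH [wt _ _]alpha_coweight natrD.
Qed.

(** Linear independence of the simple roots, at the level of words. *)
Lemma perm_of_wt s t : wt (root_sum D s) = wt (root_sum D t) -> perm_eq s t.
Proof.
move=> st; apply/allP => j _ /=.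
by rewrite -(eqr_nat R[i]) -!wt_coweight st.
Qed.

Lemma positive_cone_wt_inj b c : positive_cone D b -> positive_cone D c ->
  wt b = wt c -> b = c.
Proof.
move=> /positive_coneP[s ->] /positive_coneP[t ->] /perm_of_wt.
exact: perm_big.
Qed.

(** If b + c = s0 + t0 in Q_+, a word for b followed by a word for c is a
    permutation of one for s0 + t0, so b is the sum of a prefix of one of
    finitely many words. *)
Lemma finite_positive_cone_below m : finite_set
  [set b | positive_cone D b /\ exists2 c, positive_cone D c & wt b + wt c = m].
Proof.
set S := [set b | _].
have [->|/set0P[b0 [+ [c0]]]] := eqVneq S set0; first exact: finite_set0.
move=> /positive_coneP[s0 ->] /positive_coneP[t0 ->].
rewrite -raddfD -root_sum_cat; set u := s0 ++ t0 => mE.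
apply: (@sub_finite_set _ _ [set` [seq root_sum D (take k s) |
  s <- permutations u, k <- iota 0 (size u).+1]]); last exact: finite_seq.
move=> b [/positive_coneP[s ->]] [c /positive_coneP[t ->]].
rewrite -raddfD -root_sum_cat -mE => /perm_of_wt stu.
apply/allpairsPdep; exists (s ++ t), (size s); split.
- by rewrite mem_permutations.
- by rewrite mem_iota add0n ltnS -(perm_size stu) size_cat leq0n leq_addr.
- by rewrite take_size_cat.
Qed.

Lemma positive_coneB_letter i (l k : nat) b : positive_cone D b ->
  wt b (coweight i) = k%:R -> (l <= k)%N ->
  positive_cone D (b - bc_alpha D i *+ l).
Proof.
move=> /positive_coneP[t ->]; rewrite wt_coweight => /eqP; rewrite eqr_nat.
move=> /eqP <- lk; apply/positive_coneP.
have tE : perm_eq t (nseq (count_mem i t) i ++ [seq j <- t | j != i]).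
  rewrite -(perm_filterC (pred1 i) t) perm_cat2r.
  by have /all_pred1P -> := filter_all (pred1 i) t; rewrite size_filter.
exists (nseq (count_mem i t - l) i ++ [seq j <- t | j != i]).
rewrite {1}/root_sum (perm_big _ tE) -/(root_sum _ _) /= !root_sum_cat.
by rewrite !root_sum_nseq addrAC mulrnBr.
Qed.
End CartanForm.

(** * The triangular decomposition *)

Section Algebra.
Variables (R : realType) (I : countType) (D : bc_datum R I).
Variable g : bb_superalgebra D.
Implicit Types (x : g) (i j : I) (k l : nat) (t : seq I).
Implicit Types (m n : {scalar bc_cartan D}).
Local Notation h := (gen_h (bb_gen g)).
Local Notation e := (gen_e (bb_gen g)).
Local Notation f := (gen_f (bb_gen g)).
Local Notation br := (ls_br g).
Local Notation grel := (bb_rel g).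

Definition eigenspace (m : {scalar bc_cartan D}) : set g :=
  [set x | forall y, br (h y) x = m y *: x].

Lemma eigenspace_subspace m : is_subspace (eigenspace m).
Proof.
split=> [y|a x z mx mz y]; first by rewrite linear0r scaler0.
by rewrite linearPr /= mx mz scalerDr !scalerA mulrC.
Qed.

Lemma eigenspace_bracket m n x y :
  eigenspace m x -> eigenspace n y -> eigenspace (m + n) (br x y).
Proof.
move=> mx ny z; rewrite (even_bracketDr _ _ (rel_par_h grel z)) mx ny.
by rewrite linearZl_LR linearZr_LR /= -scalerDl.
Qed.

Lemma eigenspace_h y : eigenspace 0 (h y).
Proof. by move=> z; rewrite (rel_hh grel) scale0r. Qed.

Lemma alphaMnE i l y : wt (bc_alpha D i *+ l) y = l%:R * alpha D i y.
Proof.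
elim: l => [|l IH]; first by rewrite mulr0n raddf0 mul0r.
by rewrite mulrSr wtDE IH -natr1 mulrDl mul1r.
Qed.

Lemma root_space_e i l :
  in_Iinf D i l -> root_space (bc_alpha D i *+ l) (e i l).
Proof. by move=> il y; rewrite (rel_he grel) // alphaMnE. Qed.

Lemma root_space_f i l :
  in_Iinf D i l -> root_space (- (bc_alpha D i *+ l)) (f i l).
Proof. by move=> il y; rewrite (rel_hf grel) // wtNE alphaMnE. Qed.

(** The product of the operators ad h - a over the pairs (h, a) in s.  Such
    products separate the simultaneous eigenspaces of h. *)
Definition shifted_ad (s : seq (bc_cartan D * R[i])) x : g :=
  foldr (fun p z => br (h p.1) z - p.2 *: z) x s.

Lemma shifted_ad_linear s a x y :
  shifted_ad s (a *: x + y) = a *: shifted_ad s x + shifted_ad s y.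
Proof.
elim: s => //= p s ->; rewrite linearPr /= scalerBr scalerDr opprD addrACA.
by rewrite !scalerA [p.2 * a]mulrC.
Qed.

Lemma shifted_ad_eigen s m x : eigenspace m x ->
  shifted_ad s x = \prod_(p <- s) (m p.1 - p.2) *: x.
Proof.
move=> mx; elim: s => [|p s IH] /=; first by rewrite big_nil scale1r.
rewrite big_cons IH linearZr_LR /= mx !scalerA -scalerBl mulrBl.
by rewrite [_ * m _]mulrC.
Qed.

(** A sum of eigenvectors of weights other than m is killed by a product of
    operators ad h - n(h) with n(h) <> m(h), and such a product acts on the
    eigenspace of m by a nonzero scalar. *)
Lemma eigenspace_independent m x :
  spanned (fun y => exists2 n, n != m & eigenspace n y) x -> eigenspace m x ->
  x = 0.
Proof.
move=> spanx mx.
have [s /allP s_ok sx0] : exists2 s, all (fun p => m p.1 != p.2) s &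
    shifted_ad s x = 0.
  elim: spanx => [|a u w [n nm nu] _ [s s_ok sw0]]; first by exists [::].
  have [y nmy] : exists y, n y != m y.
    apply: contrapT => nex; case/eqP: nm; apply: scalar_ext => y.
    by apply: contrapT => ny; apply: nex; exists y; apply/eqP.
  exists ((y, n y) :: s) => /=; first by rewrite eq_sym nmy.
  rewrite shifted_ad_linear sw0 addr0 (shifted_ad_eigen s nu).
  rewrite !linearZr_LR /= nu !scalerA.
  by rewrite -[n y * a * _]mulrA [n y * _]mulrC subrr.
move: sx0; rewrite (shifted_ad_eigen s mx) => /eqP.
rewrite scaler_eq0 prodf_seq_eq0 => /orP[/hasP[p /s_ok /=]|/eqP //].
by rewrite subr_eq0 => /negbTE ->.
Qed.

(** Iterated brackets of the letters x_il, together with their degree; the word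
    t contains i with the multiplicity of alpha_i in that degree. *)
Inductive monomial (x : I -> nat -> g) : seq I -> g -> Prop :=
| monomial_letter i l : in_Iinf D i l -> monomial x (nseq l i) (x i l)
| monomial_bracket i l t y : in_Iinf D i l -> monomial x t y ->
    monomial x (nseq l i ++ t) (br (x i l) y).

Lemma monomial_root_space_e t x :
  monomial e t x -> root_space (root_sum D t) x.
Proof.
elim=> [i l il|i l {}t y il _ ty].
  by rewrite root_sum_nseq; exact: root_space_e.
rewrite root_sum_cat root_sum_nseq /root_space raddfD.
exact: (eigenspace_bracket (root_space_e il)).
Qed.

Lemma monomial_root_space_f t x :
  monomial f t x -> root_space (- root_sum D t) x.
Proof.
elim=> [i l il|i l {}t y il _ ty].
  by rewrite root_sum_nseq; exact: root_space_f.
rewrite root_sum_cat root_sum_nseq opprD /root_space raddfD.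
exact: (eigenspace_bracket (root_space_f il)).
Qed.

(** The two halves of the triangular decomposition are treated at once: a, b are
    the families e, f, or f, e. *)
Section Half.
Variables a b : I -> nat -> g.
Hypothesis a_par : forall i l, in_Iinf D i l -> ls_par g (bc_odd D i) (a i l).
Hypothesis b_par : forall i l, in_Iinf D i l -> ls_par g (bc_odd D i) (b i l).
Hypothesis ab : forall i l j k, in_Iinf D i l -> in_Iinf D j k ->
  exists y, br (a i l) (b j k) = h y.
Hypothesis b_eigen : forall t y, monomial b t y -> exists m, eigenspace m y.

Definition half x : Prop := (exists y, x = h y) \/ (exists t, monomial b t x).

Lemma bracket_letter_h i l y : in_Iinf D i l -> spanned half (br (b i l) (h y)).
Proof.
move=> il; have [m bm] := b_eigen (monomial_letter b il).
rewrite (ls_anti (b_par il) (rel_par_h grel y)) andbF scale1r bm -scaleNr.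
apply: (subspaceZ (spanned_subspace _)); apply: spannedW; right.
by exists (nseq l i); apply: monomial_letter.
Qed.

Lemma bracket_letter_half i l x : in_Iinf D i l -> spanned half x ->
  spanned half (br (b i l) x).
Proof.
move=> il; apply: linear_spanned x; first exact: spanned_subspace.
move=> x [[y ->]|[t tx]]; first exact: bracket_letter_h.
apply: spannedW; right.
by exists (nseq l i ++ t); apply: monomial_bracket.
Qed.

(** A letter a_il passes through a bracket of letters b_jk by the Jacobi
    identity, and turns one letter into an element of h, which acts on the
    rest by a scalar. *)
Lemma opposite_letter_half i l t x : in_Iinf D i l -> monomial b t x ->
  spanned half (br (a i l) x).
Proof.
move=> il; elim=> [j k jk|j k {}t {}x jk tx IH].
  by apply: spannedW; left; apply: ab.
rewrite (ls_jacobi _ (a_par il) (b_par jk)).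
have [y ->] := ab il jk; have [m mx] := b_eigen tx.
apply: (subspaceD (spanned_subspace _)); last first.
  by apply/(subspaceZ (spanned_subspace _))/bracket_letter_half.
rewrite mx; apply: (subspaceZ (spanned_subspace _)).
by apply: spannedW; right; exists t.
Qed.
End Half.

Definition triangular_component (m : {scalar bc_cartan D}) x : Prop :=
  [\/ exists2 t, m = wt (root_sum D t) & monomial e t x,
      m = 0 /\ (exists y, x = h y)
    | exists2 t, m = - wt (root_sum D t) & monomial f t x].

Local Notation triangular :=
  (spanned (fun x => exists m, triangular_component m x)).

Lemma triangular_component_eigen m x :
  triangular_component m x -> eigenspace m x.
Proof.
case=> [[t ->]|[-> [y ->]]|[t ->]].
- exact: monomial_root_space_e.
- exact: eigenspace_h.
- by rewrite -raddfN; exact: monomial_root_space_f.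
Qed.

Lemma half_e_triangular x : spanned (half e) x -> triangular x.
Proof.
apply: spanned_sub => {}x [[y xE]|[t tx]].
  by exists 0; apply: Or32; split=> //; exists y.
by exists (wt (root_sum D t)); apply: Or31; exists t.
Qed.

Lemma half_f_triangular x : spanned (half f) x -> triangular x.
Proof.
apply: spanned_sub => {}x [[y xE]|[t tx]].
  by exists 0; apply: Or32; split=> //; exists y.
by exists (- wt (root_sum D t)); apply: Or33; exists t.
Qed.

(** The homogeneous elements that preserve the sum of n_-, h and n_+.  By the
    Jacobi identity their sums form a subalgebra; homogeneity is imposed
    because that identity carries signs. *)
Definition stabilizer (p : bool) : set g :=
  [set x | ls_par g p x /\ forall y, triangular y -> triangular (br x y)].

Lemma stabilizer_subspace p : is_subspace (stabilizer p).
Proof.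
split=> [|a x y [parx Sx] [pary Sy]].
  split=> [|y _]; first by case: (ls_par_sub g p).
  by rewrite linear0l; apply: spanned0.
split=> [|z tz]; first by case: (ls_par_sub g p) => _; apply.
rewrite linearPl /=; apply: (subspaceD (spanned_subspace _)); last exact: Sy.
exact/(subspaceZ (spanned_subspace _))/Sx.
Qed.

Lemma stabilizer_bracket p q x y :
  stabilizer p x -> stabilizer q y -> stabilizer (p (+) q) (br x y).
Proof.
move=> [parx Sx] [pary Sy]; split=> [|z tz]; first exact: ls_br_par.
have /eqP := ls_jacobi z parx pary; rewrite -subr_eq => /eqP <-.
apply: (subspaceB (spanned_subspace _)); first exact/Sx/Sy.
by apply: (subspaceZ (spanned_subspace _)); apply/Sy/Sx.
Qed.

(** The sum n_- + h + n_+ is preserved by the generators, hence by the algebra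
    they generate, which is g.  So it is a subalgebra; it contains the
    generators, and is therefore g itself. *)
Lemma triangularT x : triangular x.
Proof.
have e_eigen t y : monomial e t y -> exists m, eigenspace m y.
  by move=> ty; exists (wt (root_sum D t)); apply: monomial_root_space_e.
have f_eigen t y : monomial f t y -> exists m, eigenspace m y.
  by move=> ty; exists (wt (- root_sum D t)); apply: monomial_root_space_f.
have ef i l j k : in_Iinf D i l -> in_Iinf D j k ->
    exists y, br (e i l) (f j k) = h y.
  by move=> il jk; rewrite (rel_ef grel) // -linearZ; eexists.
have fe i l j k : in_Iinf D i l -> in_Iinf D j k ->
    exists y, br (f i l) (e j k) = h y.
  move=> il jk; have [y yE] := ef _ _ _ _ jk il.
  rewrite (ls_anti (rel_par_f grel il) (rel_par_e grel jk)) yE.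
  by rewrite -scaleNr -linearZ; eexists.
have Sh y : stabilizer false (h y).
  split=> [|z]; first exact: (rel_par_h grel).
  apply: linear_spanned z; first exact: spanned_subspace.
  move=> z [m mz] /=; rewrite (triangular_component_eigen mz).
  by apply/(subspaceZ (spanned_subspace _))/spannedW; exists m.
have Se i l : in_Iinf D i l -> stabilizer (bc_odd D i) (e i l).
  move=> il; split=> [|z]; first exact: (rel_par_e grel).
  apply: linear_spanned z; first exact: spanned_subspace.
  move=> z [m [[t _ tz]|[_ [y ->]]|[t _ tz]]].
  - apply: spannedW; exists (wt (root_sum D (nseq l i ++ t))).
    by apply: Or31; exists (nseq l i ++ t) => //; apply: monomial_bracket.
  - apply/half_e_triangular/bracket_letter_h => //.
    exact: (rel_par_e grel).
  - apply/half_f_triangular/(opposite_letter_half (b := f)) => //.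
    + exact: (rel_par_e grel).
    + exact: (rel_par_f grel).
    + exact: tz.
have Sf i l : in_Iinf D i l -> stabilizer (bc_odd D i) (f i l).
  move=> il; split=> [|z]; first exact: (rel_par_f grel).
  apply: linear_spanned z; first exact: spanned_subspace.
  move=> z [m [[t _ tz]|[_ [y ->]]|[t _ tz]]].
  - apply/half_e_triangular/(opposite_letter_half (b := e)) => //.
    + exact: (rel_par_f grel).
    + exact: (rel_par_e grel).
    + exact: tz.
  - apply/half_f_triangular/bracket_letter_h => //.
    exact: (rel_par_f grel).
  - apply: spannedW; exists (- wt (root_sum D (nseq l i ++ t))).
    by apply: Or33; exists (nseq l i ++ t) => //; apply: monomial_bracket.
pose S := [set x | exists x0 x1,
  [/\ stabilizer false x0, stabilizer true x1 & x = x0 + x1]].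
have S_hom p y : stabilizer p y -> S y.
  case: p => Sy; [exists 0, y|exists y, 0]; rewrite ?add0r ?addr0.
    by split=> //; case: (stabilizer_subspace false).
  by split=> //; case: (stabilizer_subspace true).
have S_sub : is_subspace S.
  split=> [|c y z [y0 [y1 [Sy0 Sy1 ->]]] [z0 [z1 [Sz0 Sz1 ->]]]].
    by apply: (S_hom false); case: (stabilizer_subspace false).
  exists (c *: y0 + z0), (c *: y1 + z1).
  split; last by rewrite scalerDr addrACA.
    by case: (stabilizer_subspace false) => _; apply.
  by case: (stabilizer_subspace true) => _; apply.
have ST : forall y, S y.
  apply: (bb_genP (b := g)) => //.
  - move=> y z [y0 [y1 [Sy0 Sy1 ->]]] [z0 [z1 [Sz0 Sz1 ->]]].
    rewrite linearDl !linearDr; do 2!apply: (subspaceD S_sub); apply: S_hom.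
    + exact: stabilizer_bracket Sy0 Sz0.
    + exact: stabilizer_bracket Sy0 Sz1.
    + exact: stabilizer_bracket Sy1 Sz0.
    + exact: stabilizer_bracket Sy1 Sz1.
  - by move=> y; apply: S_hom (Sh y).
  - by move=> i l il; apply: S_hom (Se i l il).
  - by move=> i l il; apply: S_hom (Sf i l il).
apply: (bb_genP (b := g)) x => //.
- exact: spanned_subspace.
- move=> y z _ tz; have [y0 [y1 [[_ Sy0] [_ Sy1] ->]]] := ST y.
  rewrite linearDl; apply: (subspaceD (spanned_subspace _)).
    exact: Sy0.
  exact: Sy1.
- by move=> y; apply: spannedW; exists 0; apply: Or32; split=> //; exists y.
- move=> i l il; apply: spannedW; exists (wt (root_sum D (nseq l i))).
  by apply: Or31; exists (nseq l i) => //; apply: monomial_letter.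
- move=> i l il; apply: spannedW; exists (- wt (root_sum D (nseq l i))).
  by apply: Or33; exists (nseq l i) => //; apply: monomial_letter.
Qed.

Lemma eigenspace_triangular m x :
  eigenspace m x -> spanned (triangular_component m) x.
Proof.
move=> mx.
have [y [z [ty tz xE]]] : exists y z,
    [/\ spanned (triangular_component m) y,
    spanned (fun z => exists2 n, n != m & eigenspace n z) z & x = y + z].
  apply: spanned_split (triangularT x) => y [n ny].
  have [<-|nm] := eqVneq n m; first by left.
  by right; exists n => //; apply: triangular_component_eigen.
suff z0 : z = 0 by rewrite xE z0 addr0.
apply: (eigenspace_independent tz).
have -> : z = x - y by rewrite xE addrC addKr.
apply: (subspaceB (eigenspace_subspace m) mx).
apply: spanned_ind_subspace ty; first exact: eigenspace_subspace.
exact: triangular_component_eigen.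
Qed.

(** The bracket is nonzero only for (j, k) = (i, l), and then i occurs l times
    in the degree of e_jk. *)
Lemma letter_bracket_f i l j k : in_Iinf D i l -> in_Iinf D j k ->
  (count_mem i (nseq k j) < l)%N -> br (e j k) (f i l) = 0.
Proof.
move=> il jk; rewrite count_nseq (rel_ef grel) //=.
case: (j == i); last by rewrite muln0 mul0n scale0r.
by rewrite mul1n => kl; rewrite gtn_eqF // muln0 scale0r.
Qed.

Lemma monomial_bracket_f i l t x : in_Iinf D i l -> monomial e t x ->
  (count_mem i t < l)%N -> br x (f i l) = 0.
Proof.
move=> il; elim=> [j k jk|j k {}t y jk ty IH]; first exact: letter_bracket_f.
rewrite count_cat => kl.
have := bracket_derivation y (f i l) (rel_par_e grel jk).
rewrite IH ?(leq_ltn_trans _ kl) ?leq_addl // letter_bracket_f //; last first.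
  by rewrite (leq_ltn_trans _ kl) ?leq_addr.
by rewrite !linear0r addr0 => <-.
Qed.

(** A root vector of positive degree is a combination of brackets of letters
    e_jk of the same degree. *)
Lemma root_bracket_f (B : cartan_form D) b x i l k :
  in_Iinf D i l -> positive_roots g b -> root_space b x ->
  wt b (coweight B i) = k%:R -> (k < l)%N -> br x (f i l) = 0.
Proof.
move=> il [[_ b_neq0 _] bpos] bx bk kl.
have b_zero : wt b = 0 -> b = 0.
  move=> b0; apply: (positive_cone_wt_inj B bpos); last by rewrite raddf0.
  by apply/positive_coneP; exists [::]; rewrite /root_sum big_nil.
apply: (spanned_ind_subspace (S := [set x | br x (f i l) = 0]))
  (eigenspace_triangular bx).
  split=> [|a y z /= y0 z0]; first by rewrite /= linear0l.
  by rewrite linearPl y0 z0 scaler0 addr0.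
move=> {bx}x [[t bt tx]|[b0 _]|[t bt tx]] /=.
- apply: monomial_bracket_f tx _ => //.
  by move: bk; rewrite bt wt_coweight => /eqP; rewrite eqr_nat => /eqP ->.
- by case/eqP: b_neq0; apply: b_zero.
- case/eqP: b_neq0; have /positive_coneP[s bs] := bpos.
  have st : wt (root_sum D (s ++ t)) = wt (root_sum D [::]).
    by rewrite root_sum_cat raddfD /= -bs bt addNr /root_sum big_nil raddf0.
  have := perm_size (perm_of_wt B st); rewrite size_cat bs.
  by case: (s) => //; rewrite /root_sum big_nil.
Qed.
End Algebra.

(** * The invariant form and dual bases *)

Section Form.
Variables (R : realType) (I : countType) (D : bc_datum R I) (B : cartan_form D).
Variables (g : bb_superalgebra D) (F : invariant_form B g).
Implicit Types (b c : bc_P D) (p q : bool) (i : I) (l : nat).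
Local Notation h := (gen_h (bb_gen g)).
Local Notation br := (ls_br g).
Local Notation grel := (bb_rel g).
Local Notation pos := (positive_roots g).

Lemma root_space_subspace b : is_subspace (root_space (g := g) b).
Proof. exact: (@eigenspace_subspace _ _ _ g (wt b)). Qed.

Lemma root_space_bracket b c (x y : g) :
  root_space b x -> root_space c y -> root_space (b + c) (br x y).
Proof. by rewrite /root_space raddfD; apply: eigenspace_bracket. Qed.

Lemma root_space_parity b (x0 x1 : g) :
  ls_par g false x0 -> ls_par g true x1 -> root_space b (x0 + x1) ->
  root_space b x0 /\ root_space b x1.
Proof.
move=> par0 par1 bx.
have E y : br (h y) x0 = wt b y *: x0 /\ br (h y) x1 = wt b y *: x1.
  apply: (@parity_unique _ g).
  - exact: ls_br_par (rel_par_h grel y) par0.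
  - exact: ls_br_par (rel_par_h grel y) par1.
  - exact: (subspaceZ (ls_par_sub g _)).
  - exact: (subspaceZ (ls_par_sub g _)).
  - by rewrite -linearDr bx scalerDr.
by split=> y; have [] := E y.
Qed.

Lemma root_space_twist p b (x : g) : root_space b x -> root_space b (twist p x).
Proof.
have [x0 [x1 [par0 par1 -> ->]]] := twistP p x => bx.
have [bx0 bx1] := root_space_parity par0 par1 bx.
apply: (subspaceD (root_space_subspace b)) bx0 _.
exact: (subspaceZ (root_space_subspace b)).
Qed.

(** The form on g restricts to the nondegenerate form on h. *)
Lemma gen_h_inj y : h y = 0 -> y = 0.
Proof.
move=> hy; apply: (cf_nondeg (c := B)) => y'.
by rewrite -(if_cartan F) hy linear0l.
Qed.

Lemma gen_h_root_neq0 b : pos b -> h (cf_nuinv B (wt b)) != 0.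
Proof.
move=> [[_ b_neq0 _] bpos]; apply: contra_neq b_neq0 => /gen_h_inj b0.
apply: (positive_cone_wt_inj B bpos).
  by apply/positive_coneP; exists [::]; rewrite /root_sum big_nil.
by apply: scalar_ext => y; rewrite -(form_nuinv B) b0 linear0l raddf0.
Qed.

(** The bracket [x, y] is odd, and it is also the multiple (x, y) nu^-1(b) of a
    nonzero even vector. *)
Lemma form_parity p q b (x y : g) : p != q -> pos b ->
  ls_par g p x -> ls_par g q y ->
  root_space b x -> root_space (- b) y -> F x y = 0.
Proof.
move=> pq bpos px qy bx by_; apply/eqP.
have := if_bracket F bpos bx by_; have := ls_br_par px qy.
rewrite -negb_eqb pq => br1 brE; move: br1; rewrite {}brE => br1.
have : F x y *: h (cf_nuinv B (wt b)) == 0.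
  apply/eqP/parity_disjoint => //.
  exact: (subspaceZ (ls_par_sub g _)) (rel_par_h grel _).
by rewrite scaler_eq0 (negbTE (gen_h_root_neq0 bpos)) orbF.
Qed.

Lemma form_twist p b (x y : g) :
  pos b -> root_space b x -> root_space (- b) y ->
  F (twist p x) y = F x (twist p y).
Proof.
move=> bpos.
have [x0 [x1 [px0 px1 -> ->]]] := twistP p x.
have [y0 [y1 [py0 py1 -> ->]]] := twistP p y.
move=> /(root_space_parity px0 px1)[bx0 bx1].
move=> /(root_space_parity py0 py1)[by0 by1].
rewrite !(linearDl, linearDr) !linearZl_LR !linearZr_LR /=.
rewrite (form_parity _ bpos px0 py1 bx0 by1) //.
rewrite (form_parity _ bpos px1 py0 bx1 by0) //.
by rewrite !mulr0 !addr0.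
Qed.

(** The form pairs g_b and g_(-b) nondegenerately, since it vanishes between all
    other pairs of root spaces. *)
Lemma positive_root_dual b (y : g) : positive_cone D b -> b != 0 ->
  root_space (- b) y -> y != 0 -> pos b.
Proof.
move=> bpos b_neq0 by_ y_neq0.
have [t bt] : exists t, b = root_sum D t by apply/positive_coneP.
split=> //; split=> //; first by rewrite bt; apply: root_lattice_sum.
apply: contrapT => b_no_root; case/eqP: y_neq0.
apply: (if_nondegr (i := F)) => x.
have b_lat : root_lattice D (- b) by exists t, (fun=> - 1); rewrite bt -sumrN.
have orth c z : root_lattice D c -> root_space c z -> F z y = 0.
  move=> c_lat cz; have [cb|cb] := eqVneq (c + - b) 0; last first.
    exact: if_orth cb cz by_.
  have [->|z_neq0] := eqVneq z 0; first by rewrite linear0l.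
  case: b_no_root; exists z => //; rewrite (_ : b = c) //.
  by apply/eqP; rewrite eq_sym -subr_eq0 cb.
apply: (spanned_ind_subspace (S := [set x | F x y = 0])) (triangularT x).
  split=> [|a z z' /= Fz Fz']; first exact: linear0l.
  by rewrite linearPl Fz Fz' mulr0 addr0.
move=> z [m [[s ms sz]|[m0 [u zE]]|[s ms sz]]].
- apply: (orth (root_sum D s)); first exact: root_lattice_sum.
  exact: monomial_root_space_e.
- apply: (orth 0); first by exists [::], (fun=> 0); rewrite big_nil.
  by rewrite zE /root_space raddf0; apply: eigenspace_h.
- apply: (orth (- root_sum D s)); last exact: monomial_root_space_f.
  by exists s, (fun=> - 1); rewrite -sumrN.
Qed.

Lemma generator_root i l : in_Iinf D i l -> pos (bc_alpha D i *+ l).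
Proof.
move=> il; have l_gt0 : (0 < l)%N by case/orP: (il) => /andP[_] // /eqP ->.
have cone : positive_cone D (bc_alpha D i *+ l).
  by apply/positive_coneP; exists (nseq l i); rewrite root_sum_nseq.
split=> //; split.
- by rewrite -root_sum_nseq; apply: root_lattice_sum.
- apply: contraTneq l_gt0 => l0; rewrite -leqNgt leqn0.
  have := alphaMnE i l (coweight B i).
  rewrite l0 raddf0 alpha_coweight eqxx mulr1.
  by move/esym/eqP; rewrite pnatr_eq0.
- exists (gen_e (bb_gen g) i l); first exact: root_space_e.
  apply/eqP => e0; have := rel_ef grel il il; rewrite e0 linear0l !eqxx !muln1.
  move/esym/eqP; rewrite scaler_eq0 pnatr_eq0 -leqn0 leqNgt l_gt0 /=.
  by move/eqP/gen_h_inj/eqP; rewrite (negbTE (hh_neq0 D i)).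
Qed.

Variable E : dual_bases F.

Lemma pos_expansion b x : pos b -> root_space b x ->
  x = \sum_k F x (db_neg E b k) *: db_pos E b k.
Proof.
move=> bpos bx; have [_ _ /(_ x bx)[c xE]] := db_pos_basis E bpos.
rewrite {1}xE; apply: eq_bigr => k _; congr (_ *: _).
rewrite xE linear_sumlz (bigD1 k) //= linearZl_LR /= db_dual // eqxx mulr1.
rewrite big1 ?addr0 // => k' /negbTE kk'.
by rewrite linearZl_LR /= db_dual // kk' mulr0.
Qed.

Lemma neg_expansion b y : pos b -> root_space (- b) y ->
  y = \sum_k F (db_pos E b k) y *: db_neg E b k.
Proof.
move=> bpos by_; have [_ _ /(_ y by_)[c yE]] := db_neg_basis E bpos.
rewrite {1}yE; apply: eq_bigr => k _; congr (_ *: _).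
rewrite yE linear_sumr (bigD1 k) //= linearZr_LR /= db_dual // eqxx mulr1.
rewrite big1 ?addr0 // => k' /negbTE kk'.
by rewrite linearZr_LR /= db_dual // eq_sym kk' mulr0.
Qed.

Lemma db_posP b k : pos b -> root_space b (db_pos E b k).
Proof. by move=> bpos; have [] := db_pos_basis E bpos. Qed.

Lemma db_negP b k : pos b -> root_space (- b) (db_neg E b k).
Proof. by move=> bpos; have [] := db_neg_basis E bpos. Qed.

(** Expanding T e_k in the basis of g_c and T' e'_k' in the basis of g_(-b)
    gives the same double sum, whose coefficients are (T e_k, e'_k'). *)
Lemma dual_bases_adjoint (V W : lmodType R[i]) (m : {bilinear g -> V -> W})
    (L : {linear g -> V}) (T T' : g -> g) b c : pos b -> pos c ->
  (forall x, root_space b x -> root_space c (T x)) ->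
  (forall y, root_space (- c) y -> root_space (- b) (T' y)) ->
  (forall x y, root_space b x -> root_space (- c) y ->
     F (T x) y = F x (T' y)) ->
  \sum_k m (db_neg E b k) (L (T (db_pos E b k))) =
  \sum_k m (T' (db_neg E c k)) (L (db_pos E c k)).
Proof.
move=> bpos cpos Tbc Tcb adj.
under eq_bigr => k _.
  rewrite (pos_expansion cpos (Tbc _ (db_posP k bpos))) linear_sum linear_sumr.
  under eq_bigr do rewrite linearZ linearZr_LR /=.
  over.
rewrite exchange_big /=; apply: eq_bigr => k' _.
rewrite [in RHS](neg_expansion bpos (Tcb _ (db_negP k' cpos))) linear_sumlz.
apply: eq_bigr => k _; rewrite linearZl_LR /= adj //.
  exact: db_posP.
exact: db_negP.
Qed.
End Form.

(** * The Casimir operator *)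

Section Casimir.
Variables (R : realType) (I : countType) (D : bc_datum R I) (B : cartan_form D).
Variables (g : bb_superalgebra D) (F : invariant_form B g) (E : dual_bases F).
Variables (M : ls_module g) (hM : in_category_M M).
Implicit Types (a b c : bc_P D) (m : {scalar bc_cartan D}) (v w : M).
Local Notation h := (gen_h (bb_gen g)).
Local Notation br := (ls_br g).
Local Notation act := (mod_act M).
Local Notation grel := (bb_rel g).
Local Notation pos := (positive_roots g).

Lemma act_weight_space b m x v : root_space b x -> weight_space m v ->
  weight_space (m + wt b) (act x v).
Proof.
move=> bx mv y; have := act_bracket_even x v (rel_par_h grel y).
rewrite bx mv linearZl_LR linearZr_LR /= => /eqP.
by rewrite eq_sym subr_eq -scalerDl addrC => /eqP.
Qed.

(** Only the root vectors of these degrees can act nontrivially on a vector of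
    weight m. *)
Definition raised_roots m : set (bc_P D) :=
  [set b | pos b /\ exists2 w, weight_space (M := M) (m + wt b) w & w != 0].

(** If m + b lies in n - Q_+ for one of finitely many n, then b is at most
    n - m. *)
Lemma finite_raised_roots m : finite_set (raised_roots m).
Proof.
have [_ _ [s sP]] := hM.
apply: (@sub_finite_set _ _ (\bigcup_(n in [set` s])
  [set b | positive_cone D b /\
     exists2 c, positive_cone D c & wt b + wt c = n - m])); last first.
  by apply: bigcup_finite => // n _; apply: (finite_positive_cone_below B).
move=> b [[_ bpos] /sP[n ns [c cpos nE]]]; exists n => //=; split=> //.
exists c => //; apply/eqP.
by rewrite eq_sym subr_eq addrC addrA nE subrK.
Qed.

Lemma raised_rootsP b m x v : pos b -> root_space b x -> weight_space m v ->
  ~ raised_roots m b -> act x v = 0.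
Proof.
move=> bpos bx mv b_notin; apply/eqP; apply: contra_notT b_notin => xv.
by split=> //; exists (act x v) => //; apply: act_weight_space.
Qed.

Definition casimir_term b w : M :=
  \sum_k act (db_neg E b k) (act (db_pos E b k) w).

Variables (i : I) (l : nat) (il : in_Iinf D i l) (m : {scalar bc_cartan D}).
Variables (v : M) (mv : weight_space m v).
Local Notation z := (gen_f (bb_gen g) i l).
Local Notation c := (bc_alpha D i *+ l).

Definition raising_term b : M :=
  \sum_k act (db_neg E b k) (act (br (db_pos E b k) z) v).

Definition lowering_term b : M :=
  \sum_k act (br z (db_neg E b k)) (act (db_pos E b k) v).

(** The twist arises when z passes e_k; adjointness moves it to e'_k, where
    it is undone when z passes that factor as well. *)
Lemma casimir_term_commutator b : pos b ->
  casimir_term b (act z v) =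
  raising_term b + (act z (casimir_term b v) - lowering_term b).
Proof.
move=> bpos; pose p := bc_odd D i.
have z_par : ls_par g p z by exact: (rel_par_f grel).
pose L : {linear g -> M} := act z \o applyr act v.
transitivity (raising_term b +
    \sum_k act (db_neg E b k) (L (twist p (db_pos E b k)))).
  rewrite -big_split; apply: eq_bigr => k _ /=.
  rewrite -linearDr; congr (act _ _).
  by rewrite (act_bracketr _ _ z_par) subrK.
congr (_ + _).
rewrite (dual_bases_adjoint E act L (T := twist p) (T' := twist p) (c := b)) //.
- rewrite linear_sumr -sumrB; apply: eq_bigr => k _ /=.
  by rewrite (act_bracketl _ _ z_par) opprB addrC subrK.
- exact: root_space_twist.
- exact: root_space_twist.
- by move=> x y; apply: form_twist.
Qed.

Lemma raising_term_shift b : pos b -> pos (b + c) ->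
  raising_term (b + c) = lowering_term b.
Proof.
move=> bpos bcpos.
rewrite /raising_term /lowering_term.
apply: (dual_bases_adjoint E act (applyr act v)
  (T := fun x => br x z) (T' := br z)) => //.
- move=> x bx; have := root_space_bracket bx (root_space_f g il).
  by rewrite addrK.
- move=> y by_; have := root_space_bracket (root_space_f g il) by_.
  by rewrite -opprD addrC.
- by move=> x y _ _; apply: if_invariant.
Qed.

Lemma raising_term_generator :
  raising_term c = dual_form B m (wt c) *: act z v.
Proof.
have cpos := generator_root F il; have cz := root_space_f g il.
rewrite dual_formE [in RHS](neg_expansion E cpos cz) linear_sumlz scaler_sumr.
apply: eq_bigr => k _.
rewrite (if_bracket F cpos (db_posP k cpos) cz) !linearZl_LR /= mv.
by rewrite linearZr_LR linearZr_LR /= !scalerA mulrC.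
Qed.

(** If b - c is in Q_+ without being a root, then g_(b - c) vanishes; if it is
    not in Q_+, the multiplicity of alpha_i in b is less than l. *)
Lemma raising_term_eq0 b : pos b -> b != c -> ~ pos (b - c) ->
  raising_term b = 0.
Proof.
move=> bpos bc bc_notpos; apply: big1 => k _.
suff -> : br (db_pos E b k) z = 0 by rewrite linear0l linear0r.
have [bcone|bcone] := pselect (positive_cone D (b - c)); last first.
  have [t bE] : exists t, b = root_sum D t by apply/positive_coneP; case: bpos.
  have bi := wt_coweight B t i; rewrite -bE in bi.
  apply: (root_bracket_f il bpos (db_posP k bpos) bi).
  rewrite ltnNge; apply/negP => lt; apply: bcone.
  by apply: positive_coneB_letter bi lt; case: bpos.
apply: contrapT => /eqP brk; apply: bc_notpos; split=> //; split.
- by have [t ->] := (positive_coneP (b - c)).1 bcone; apply: root_lattice_sum.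
- by rewrite subr_eq0.
- exists (br (db_pos E b k) z) => //.
  exact: root_space_bracket (db_posP k bpos) (root_space_f g il).
Qed.

(** The bracket lies in g_(-b - c), which vanishes because g_(b + c) does. *)
Lemma lowering_term_eq0 b : pos b -> ~ pos (b + c) -> lowering_term b = 0.
Proof.
move=> bpos bc_notpos; apply: big1 => k _.
suff -> : br z (db_neg E b k) = 0 by rewrite linear0l.
have [_ /positive_coneP[s bE]] := bpos.
have cE : c = root_sum D (nseq l i) by rewrite root_sum_nseq.
apply: contrapT => /eqP brk; apply: bc_notpos.
apply: (positive_root_dual F _ _ _ brk).
- by apply/positive_coneP; exists (s ++ nseq l i); rewrite root_sum_cat -cE bE.
- have [_ cone] := bpos; case: (bpos) => -[_ + _] _; apply: contra_neq => bc0.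
  have : wt (root_sum D (s ++ nseq l i)) = wt (root_sum D [::]).
    by rewrite root_sum_cat -cE -bE bc0 /root_sum big_nil.
  move/(perm_of_wt B)/perm_size; rewrite size_cat bE; case: (s) => //.
  by rewrite /root_sum big_nil.
- have := root_space_bracket (root_space_f g il) (db_negP k bpos).
  by rewrite -opprD addrC.
Qed.

Lemma act_f_weight_space : weight_space (m - wt c) (act z v).
Proof. by rewrite -raddfN; apply: act_weight_space (root_space_f g il) mv. Qed.

(** All sums over positive roots are finite, so the corrections can be summed
    separately; the shift by c then matches them, except for the one at c. *)
Lemma Omega0_commutator :
  Omega0 E (act z v) - act z (Omega0 E v) =
  (2 * dual_form B m (wt c)) *: act z v.
Proof.
have cpos := generator_root F il.
pose Z := (raised_roots m `|` raised_roots (m - wt c)) `|` [set c].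
have Zfin : finite_set Z.
  rewrite !finite_setU; split; last exact: finite_set1.
  by split; apply: finite_raised_roots.
have Zpos : Z `<=` pos by move=> b [[[]|[]]|-> ].
have Z_raised b : ~ Z b -> ~ raised_roots m b /\ ~ raised_roots (m - wt c) b.
  by move=> Zb; split=> Zb'; apply: Zb; left; [left|right].
have term0 n w b : weight_space n w -> pos b -> ~ raised_roots n b ->
    casimir_term b w = 0.
  move=> nw bpos bn; apply: big1 => k _.
  by rewrite (raised_rootsP bpos (db_posP k bpos) nw bn) linear0r.
have lowering0 b : pos b -> ~ Z b -> lowering_term b = 0.
  move=> bpos /Z_raised[bm _]; apply: big1 => k _.
  by rewrite (raised_rootsP bpos (db_posP k bpos) mv bm) linear0r.
(* The three other terms of the commutator formula vanish off Z. *)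
have raising0 b : pos b -> ~ Z b -> raising_term b = 0.
  move=> bpos Zb; have := casimir_term_commutator bpos.
  have [bm bmc] := Z_raised b Zb.
  rewrite (term0 _ _ _ act_f_weight_space) // (term0 _ _ _ mv) // lowering0 //.
  by rewrite linear0r subr0 addr0.
have sumZ (G : bc_P D -> M) : (forall b, pos b -> ~ Z b -> G b = 0) ->
    \sum_(b \in pos) G b = \sum_(b \in Z) G b.
  by move=> G0; apply/esym/fsbig_widen => // b [bpos Zb]; apply: G0.
have sum_term : \sum_(b \in pos) casimir_term b (act z v) =
    \sum_(b \in pos) raising_term b +
    (act z (\sum_(b \in pos) casimir_term b v) -
     \sum_(b \in pos) lowering_term b).
  rewrite !sumZ //; last 2 first.
  - by move=> b bpos /Z_raised[bm _]; apply: term0 mv bpos bm.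
  - by move=> b bpos /Z_raised[_ bm]; apply: term0 act_f_weight_space bpos bm.
  rewrite !fsbig_finite // linear_sumr -sumrB -big_split.
  apply: eq_big_seq => b; rewrite in_fset_set // inE => /Zpos bpos.
  exact: casimir_term_commutator.
have sum_shift : \sum_(b \in pos) raising_term b =
    raising_term c + \sum_(b \in pos) lowering_term b.
  pose U := [set b | pos b /\ pos (b + c)].
  rewrite [LHS]sumZ // (fsbigD1 c) //; last by right.
  congr (_ + _).
  rewrite (_ : \sum_(b \in pos) _ = \sum_(b \in U) lowering_term b); last first.
    apply/esym/fsbig_widen => [b []//|b [bpos]].
    by move=> /not_andP[//|bc]; apply: lowering_term_eq0.
  transitivity (\sum_(b \in U) raising_term (b + c)); last first.
    apply: eq_fsbigr => b; rewrite inE => -[bpos bcpos].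
    by rewrite raising_term_shift.
  rewrite -(fsbig_image _ (fun b => b + c)); last by move=> ? ? _ _ /addIr.
  transitivity (\sum_(b \in pos `\ c) raising_term b).
    apply: fsbig_widen => [b [/Zpos]//|b [[bpos bc]]].
    by move=> /not_andP[Zb|/(_ bc)//]; apply: raising0.
  apply/esym/fsbig_widen => [_ [b [[[_ b0 _] _] bcpos] <-]|b [[bpos bc] bU]].
    split=> //= /eqP; rewrite -subr_eq0 addrK; exact/negP.
  apply: raising_term_eq0 => //; first exact/eqP.
  by move=> bcpos; apply: bU; exists (b - c); rewrite /U /= ?subrK.
rewrite /Omega0 linearZr_LR /= -scalerBr -scalerA; congr (_ *: _).
change (\sum_(b \in pos) casimir_term b (act z v) -
  act z (\sum_(b \in pos) casimir_term b v) = dual_form B m (wt c) *: act z v).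
rewrite sum_term sum_shift raising_term_generator.
by rewrite [act z _ - _]addrC addrA addrK addrK.
Qed.
End Casimir.

(** The pairings of m with l alpha_i cancel, and by the choice of rho the term
    - 2 (rho, l alpha_i) is - l (alpha_i, alpha_i). *)
Lemma casimir_scalar (R : realType) (I : countType) (D : bc_datum R I)
    (B : cartan_form D) (rho m : {scalar bc_cartan D}) (i : I) (l : nat) :
  dual_form B rho (alpha D i) = 2^-1 * dual_form B (alpha D i) (alpha D i) ->
  dual_form B (m - wt (bc_alpha D i *+ l) + 2 *: rho)
      (m - wt (bc_alpha D i *+ l)) -
    dual_form B (m + 2 *: rho) m + 2 * dual_form B m (wt (bc_alpha D i *+ l)) =
  (l%:R ^+ 2 - l%:R) * dual_form B (alpha D i) (alpha D i).
Proof.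
have -> : wt (bc_alpha D i *+ l) = l%:R *: alpha D i.
  by apply: scalar_ext => y; rewrite alphaMnE.
move=> rhoE; set s := alpha D i in rhoE *.
rewrite !(dual_formDl, dual_formNl, dual_formZl).
rewrite ![dual_form B _ (m - _)]dual_formC.
rewrite !(dual_formDl, dual_formNl, dual_formZl).
rewrite [dual_form B s rho]dual_formC rhoE [dual_form B s m]dual_formC.
rewrite [dual_form B m (_ *: _)]dual_formC dual_formZl.
rewrite [dual_form B s m]dual_formC.
rewrite [dual_form B m rho]dual_formC.
move: (dual_form B m m) (dual_form B m s) (dual_form B s s) (dual_form B rho m).
move=> mm ms ss rm.
by field.
Qed.

Theorem proposition3p1 (R : realType) (I : countType) (D : bc_datum R I)
    (B : cartan_form D)
    (rho : {scalar bc_cartan D})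
    (hrho : forall i,
       dual_form B rho (alpha D i) =
       2^-1 * dual_form B (alpha D i) (alpha D i))
    (g : bb_superalgebra D) (F : invariant_form B g) (E : dual_bases F)
    (M : ls_module g) (hM : in_category_M M)
    (Omega : {linear M -> M}) (hOmega : is_casimir E rho Omega)
    (lambda : {scalar bc_cartan D}) (v : M) (hv : weight_space lambda v) :
  (forall i : I, is_real D i ->
     casimir_commutator Omega (gen_f (bb_gen g) i 1) v = 0) /\
  (forall (i : I) (l : nat), is_imaginary D i -> (0 < l)%N ->
     casimir_commutator Omega (gen_f (bb_gen g) i l) v =
     ((l%:R ^+ 2 - l%:R) * dual_form B (alpha D i) (alpha D i)) *:
       mod_act M (gen_f (bb_gen g) i l) v).
Proof.
have commutator i l : in_Iinf D i l ->
    casimir_commutator Omega (gen_f (bb_gen g) i l) v =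
    ((l%:R ^+ 2 - l%:R) * dual_form B (alpha D i) (alpha D i)) *:
      mod_act M (gen_f (bb_gen g) i l) v.
  move=> il; rewrite /casimir_commutator (hOmega _ _ hv).
  rewrite (hOmega _ _ (act_f_weight_space il hv)).
  rewrite -(casimir_scalar lambda l (hrho i)) linearDr linearZr_LR /=.
  rewrite opprD addrACA (Omega0_commutator E hM il hv).
  by rewrite -scalerBl -scalerDl.
split=> [i i_real|i l i_im l_gt0]; last first.
  by apply: commutator; rewrite /in_Iinf i_im l_gt0 orbT.
rewrite commutator; last by rewrite /in_Iinf i_real.
by rewrite expr1n subrr mul0r scale0r.
Qed.
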